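(* Fix $\lambda\in\mathbb R$. For every compact $K\subset E=(0,\infty)\times\mathbb Z_{\ge0}$ there are constants $C_K,c_K>0$, depending only on $K$ and $\lambda$, such that $$\mathbb E[(\Xi_{n,\lambda}(K))_q]\le C_K^q e^{-c_Kq^3}\qquad\text{for all } q\ge1 \text{ and all } n\ge n_\lambda .$$ Moreover, for every $0\le L<\infty$, an integer $n_L$ can be chosen so that for every compact $K\subset E$ there are $C_K,c_K>0$, depending only on $K$ and $L$, for which $$\mathbb E[(\Xi_{n,\lambda}(K))_q]\le C_K^q e^{-c_Kq^3}\qquad\text{for all } q\ge1,\ \text{all } n\ge n_L \text{ and all } \lambda \text{ with } |\lambda|\le L .$$
   Context: For $\lambda\in\mathbb R$ put $p_{n,\lambda}=n^{-1}+\lambda n^{-4/3}$, and let $n_\lambda$ be a fixed integer such that $p_{n,\lambda}\in(0,1)$ for every $n\ge n_\lambda$. $G(n,p)$ is the Erdős–Rényi random graph on $n$ labelled vertices with independent edges of probability $p$. For a graph $G$, $\mathcal C(G)$ is its set of connected components; for a component $C$, $|C|$ is its number of vertices, $e(C)$ its number of edges, and $\operatorname{sp}(C)=e(C)-|C|+1$ its surplus. $E=(0,\infty)\times\mathbb Z_{\ge0}$ has the product topology ($\mathbb Z_{\ge0}$ discrete), so a compact subset of $E$ has size coordinates in a compact subinterval of $(0,\infty)$ and involves only finitely many surplus values. The marked point process is $$\Xi_{n,\lambda}=\sum_{C\in\mathcal C(G(n,p_{n,\lambda}))}\delta_{(n^{-2/3}|C|,\operatorname{sp}(C))}$$ (atoms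 counted with multiplicity). Falling factorial: $(m)_q=m(m-1)\cdots(m-q+1)$. *)

(* Defs.v *)
From HB Require Import structures.
From mathcomp Require Import all_boot all_order all_algebra.
From mathcomp Require Import all_classical all_reals all_analysis.

Set Implicit Arguments.
Unset Strict Implicit.
Unset Printing Implicit Defensive.

Import Order.TTheory GRing.Theory Num.Theory.
Import numFieldNormedType.Exports.

Local Open Scope ring_scope.

Section Graphs.
Variable n : nat.

Definition vertex_pairs : {set {set 'I_n}} := [set e : {set 'I_n} | #|e| == 2]%SET.

(* A simple graph on 'I_n is given by its edge set G \subset vertex_pairs.
   Such a G has no edge of the form [set i; i], so [adj G] is irreflexive. *)
Definition adj (G : {set {set 'I_n}}) : rel 'I_n :=
  fun i j => [set i; j]%SET \in G.

Definition components (G : {set {set 'I_n}}) : {set {set 'I_n}} :=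
  equivalence_partition (connect (adj G)) [set: 'I_n]%SET.

Definition edges_in (G : {set {set 'I_n}}) (C : {set 'I_n}) : {set {set 'I_n}} :=
  [set e in G | e \subset C]%SET.

(* e(C) - |C| + 1. A component C is connected, so |C| <= e(C) + 1 and the
   natural-number subtraction does not truncate. *)
Definition surplus (G : {set {set 'I_n}}) (C : {set 'I_n}) : nat :=
  (#|edges_in G C| + 1 - #|C|)%N.

End Graphs.

Section RandomGraph.
Variables (R : realType) (n : nat).

Definition gnp_prob (p : R) (G : {set {set 'I_n}}) : R :=
  \prod_(e in vertex_pairs n) (if e \in G then p else 1 - p).

Definition gnp_expect (p : R) (f : {set {set 'I_n}} -> R) : R :=
  \sum_(G : {set {set 'I_n}} | G \subset vertex_pairs n) gnp_prob p G * f G.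

Definition p_crit (lambda : R) : R :=
  n%:R^-1 + lambda * n%:R `^ (- (4 / 3)).

Definition atom (G : {set {set 'I_n}}) (C : {set 'I_n}) : R * nat :=
  (n%:R `^ (- (2 / 3)) * #|C|%:R, surplus G C).

Definition Xi (G : {set {set 'I_n}}) (K : set (R * nat)) : nat :=
  (\sum_(C in components G) (atom G C \in K))%N.

End RandomGraph.

Arguments p_crit {R} n lambda.

Section StateSpace.
Variable R : realType.

(* (0, oo) x nat inside R x nat, with nat discrete. *)
Definition stateE : set (R * nat) := [set x | 0 < x.1]%classic.

(* Compactness of a subset of the subspace stateE is the same as its
   compactness in R x nat. *)
Definition compact_in_E (K : set (R * nat)) : Prop :=
  (K `<=` stateE)%classic /\ compact K.

End StateSpace.

(* E[(Xi_{n,lambda}(K))_q], with the falling factorial m ^_ q. *)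
Definition factorial_moment (R : realType) (n : nat) (lambda : R)
    (K : set (R * nat)) (q : nat) : R :=
  gnp_expect (p_crit n lambda) (fun G : {set {set 'I_n}} => ((Xi G K) ^_ q)%:R).

(* Main.v *)
Require Import Defs.
From HB Require Import structures.
From mathcomp Require Import all_boot all_order all_algebra.
From mathcomp Require Import all_classical all_reals all_analysis.
From mathcomp Require Import ring lra fintype finset.
Import Order.TTheory GRing.Theory Num.Theory.
Import numFieldNormedType.Exports.
Local Open Scope ring_scope.

Set Implicit Arguments.
Unset Strict Implicit.
Unset Printing Implicit Defensive.

(** Write x = n^(1/3), so that p_crit n lambda = (1 + lambda / x) / x ^ 3.  A
    compact K confines the atoms to sizes in [a x^2, b x^2] and to surplus at
    most s; call such components good, and let N_W be the number of good
    components of the graph induced on a vertex set W.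

    Peeling.  Given that C is a component, the graph on W minus C is untouched
    by this information, and the remaining good components are good components
    there.  So E[(N_W)_(q+1)] is at most the sum over C of
    P(C is good) E[(N_(W minus C))_q].  Each peeled component removes at least
    a x^2 vertices, and induction bounds the q-th factorial moment by the
    product over i < q of M_i, where M_i bounds the first moment of N_S for
    every S with |S| <= n - i a x^2 ([mean_ffact_num_good]).

    First moments.  It remains to see that M_i <= C exp(- c i^2), because
    the sum of i^2 over i < q is of order q^3.  If |lambda| <= L,
    such an S has |S| p <= 1 - (i a - L) / x.  Compare p with the slightly
    subcritical density p0 = (1 - d) / |S|, d = 1 / (2 x).  At p0 the mean
    size of a cluster is at most 1 / d ([mean_cluster_size]), and N_S (a x^2)^2 is at
    most the number of connected pairs of vertices, whence E[N_S] <= 2 / a^2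
    ([mean_num_good_subcritical]).

    Change of density.  Passing from p0 to p multiplies the probability of a
    component with k vertices and e edges by
    (p / p0)^e ((1 - p) / (1 - p0))^(T - e), where T is the number of vertex
    pairs of S that meet the component.  As e is k - 1 up to a bounded error,
    the first-order terms cancel: the ratio is bounded in the critical
    window, and it is at most exp(2 - e h^2 / 4) when p = p0 (1 - h)
    ([density_ratio_ge], [density_ratio_le]).  Once i a >= 2 L + 1, h is at least i a / (2 x), and
    e h^2 is of order a x^2 (i a / x)^2 = a^3 i^2.  The subcritical first moment
    being already of the right order for components of size x^2, the bounded
    factor costs only a power C^q. *)

(** * Random subsets of a finite set *)

Section RandomSubset.
Variables (R : realType) (I : finType) (p : R).
Implicit Types (V F G H : {set I}) (f g : {set I} -> R).

(** Law of the random subset of V that keeps each element independently with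
    probability p.  The ground set V varies so that conditioning on some of
    the coordinates stays within the same family of laws. *)
Definition subset_weight V G : R := p ^+ #|G| * (1 - p) ^+ #|V :\: G|.

Definition expect V f : R := \sum_(G : {set I} | G \subset V) subset_weight V G * f G.

Lemma eq_expect V f g : (forall G, G \subset V -> f G = g G) ->
  expect V f = expect V g.
Proof. by move=> fg; apply: eq_bigr => G GV; rewrite fg. Qed.

Lemma expectZ V f c : expect V (fun G => c * f G) = c * expect V f.
Proof. by rewrite /expect big_distrr /=; apply: eq_bigr => G _; rewrite mulrCA. Qed.

Lemma expectD V f g : expect V (fun G => f G + g G) = expect V f + expect V g.
Proof. by rewrite -big_split; apply: eq_bigr => G _; rewrite mulrDr. Qed.

Lemma expect_sum (J : finType) (Q : pred J) V (f : J -> {set I} -> R) :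
  expect V (fun G => \sum_(j | Q j) f j G) = \sum_(j | Q j) expect V (f j).
Proof.
by rewrite exchange_big /=; apply: eq_bigr => G _; rewrite mulr_sumr.
Qed.

(** A random subset of V is the union of independent random subsets of F and of
    V :\: F; independence below is always reduced to this Fubini formula. *)
Lemma expect_split V F f : F \subset V ->
  expect V f = expect F (fun G => expect (V :\: F) (fun H => f (G :|: H))).
Proof.
move=> FV; rewrite /expect.
under [RHS]eq_bigr do rewrite mulr_sumr.
rewrite pair_big /=.
rewrite (reindex_onto (fun GH : {set I} * {set I} => GH.1 :|: GH.2)
           (fun G => (G :&: F, G :\: F))) /=; last first.
  by move=> G _; rewrite setID.
have eqP2 (G H : {set I}) :
    (G :|: H \subset V) && (((G :|: H) :&: F, (G :|: H) :\: F) == (G, H)) =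
    (G \subset F) && (H \subset V :\: F).
  apply/andP/andP => [[GHV /eqP [E1 E2]]|[GF]].
    by split; [rewrite -E1 subsetIr | rewrite -E2 setSD].
  rewrite subsetD => /andP[HV HF].
  rewrite subUset HV (subset_trans GF FV); split=> //.
  rewrite setIUl setDUl (setIidPl GF) (disjoint_setI0 HF) setU0.
  move: (GF); rewrite -setD_eq0 => /eqP ->; rewrite set0U.
  by move: HF; rewrite disjoints_subset setDE => /setIidPl ->.
apply: eq_big => [[G H]|[G H] /=]; first exact: eqP2.
rewrite eqP2 => /andP[GF]; rewrite subsetD => /andP[HV HF].
rewrite mulrA; congr (_ * _); rewrite /subset_weight.
have GH0 : G :&: H = set0.
  apply/disjoint_setI0; rewrite disjoint_sym.
  exact: disjointWr GF HF.
move: HF; rewrite disjoints_subset => HF.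
have -> : #|G :|: H| = (#|G| + #|H|)%N by rewrite cardsU GH0 cards0 subn0.
have -> : #|V :\: (G :|: H)| = (#|F :\: G| + #|(V :\: F) :\: H|)%N.
  rewrite -(cardsID F); congr (_ + _)%N; apply: eq_card => x; rewrite !inE.
    move: (subsetP FV x) (subsetP GF x) (subsetP HF x); rewrite inE.
    by case: (x \in F) (x \in V) (x \in G) (x \in H) => [] [] [] [] //=
      a b c; intuition.
  move: (subsetP GF x) (subsetP HF x); rewrite inE.
  by case: (x \in F) (x \in V) (x \in G) (x \in H) => [] [] [] [] //= a b; intuition.
by rewrite !exprD; ring.
Qed.

Hypothesis p01 : 0 <= p <= 1.

Lemma subset_weight_ge0 V G : 0 <= subset_weight V G.
Proof.
by case/andP: p01 => p0 p1; rewrite mulr_ge0 ?exprn_ge0 ?subr_ge0.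
Qed.

Lemma le_expect V f g : (forall G, G \subset V -> f G <= g G) ->
  expect V f <= expect V g.
Proof.
by move=> fg; apply: ler_sum => G GV; rewrite ler_wpM2l ?subset_weight_ge0 ?fg.
Qed.

Lemma expect_ge0 V f : (forall G, G \subset V -> 0 <= f G) -> 0 <= expect V f.
Proof.
by move=> f0; apply: sumr_ge0 => G GV; rewrite mulr_ge0 ?subset_weight_ge0 ?f0.
Qed.

Lemma expect_set0 f : expect set0 f = f set0.
Proof.
rewrite /expect (eq_bigl (pred1 set0)) => [|G]; last by rewrite subset0.
by rewrite big_pred1_eq /subset_weight setD0 cards0 !expr0 !mul1r.
Qed.

Lemma expect_set1 (e : I) f :
  expect [set e] f = p * f [set e] + (1 - p) * f set0.
Proof.
rewrite /expect (bigD1 [set e]) ?subxx //=; congr (_ + _).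
  by rewrite /subset_weight setDv cards0 cards1 expr1 expr0 mulr1.
rewrite (eq_bigl (pred1 set0)) => [|G].
  by rewrite big_pred1_eq /subset_weight setD0 cards0 cards1 expr0 expr1 mul1r.
rewrite subset1 /=; case: eqP => [->|] /=; last by rewrite andbT.
by apply/esym/eqP => /setP/(_ e); rewrite !inE eqxx.
Qed.

Lemma expect_cst V c : expect V (fun=> c) = c.
Proof.
have [m] := ubnP #|V|; elim: m V => // m IH V.
have [->|[e eV]] := set_0Vmem V; first by rewrite expect_set0.
move=> Vm; rewrite (@expect_split V [set e]) ?sub1set //.
rewrite (@eq_expect _ _ (fun=> c)); first by rewrite expect_set1; ring.
by move=> G _; rewrite IH //; move: Vm; rewrite (cardsD1 e) eV.
Qed.

Lemma expect_restrict V F f : F \subset V ->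
    (forall G, G \subset V -> f G = f (G :&: F)) ->
  expect V f = expect F f.
Proof.
move=> FV fF; rewrite (expect_split _ FV); apply: eq_expect => G GF.
rewrite (@eq_expect _ _ (fun=> f G)) ?expect_cst // => H.
rewrite subsetD => /andP[HV HF].
rewrite fF ?subUset ?HV ?(subset_trans GF) //.
by rewrite setIUl (setIidPl GF) (disjoint_setI0 HF) setU0.
Qed.

Lemma expect_indep V F f g : F \subset V ->
    (forall G, G \subset V -> f G = f (G :&: F)) ->
    (forall G, G \subset V -> g G = g (G :\: F)) ->
  expect V (fun G => f G * g G) = expect V f * expect V g.
Proof.
move=> FV fF gF.
rewrite (expect_restrict FV fF).
rewrite (@expect_restrict V (V :\: F) g) ?subsetDl //; last first.
  by move=> G GV; rewrite gF // setIDA (setIidPl GV).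
rewrite (expect_split _ FV) mulrC -expectZ; apply: eq_expect => G GF.
rewrite mulrC -expectZ; apply: eq_expect => H.
rewrite subsetD => /andP[HV HF].
have GHV : G :|: H \subset V by rewrite subUset HV (subset_trans GF).
rewrite fF // gF // setIUl (setIidPl GF) (disjoint_setI0 HF) setU0.
move: GF; rewrite setDUl -setD_eq0 => /eqP ->; rewrite set0U.
by move: HF; rewrite disjoints_subset setDE => /setIidPl ->.
Qed.

End RandomSubset.

(** * Components of an induced graph *)

Section GraphComponents.
Variable n : nat.
Implicit Types (C D S W : {set 'I_n}) (G H : {set {set 'I_n}}) (u v w : 'I_n).

Definition connected_on G C :=
  [forall u in C, forall v in C, connect (adj (edges_in G C)) u v].

(** C is a connected component of the graph that G induces on W.  Components are
    described intrinsically, rather than as classes of a partition, so that the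
    event can be read off from the edges that meet C. *)
Definition is_component W G C :=
  [&& C != set0, C \subset W, connected_on G C &
      [forall e in edges_in G W, (e :&: C != set0) ==> (e \subset C)]].

(** The coordinates that decide whether C is a component on W; the graph induced
    on W :\: C depends on the other ones only. *)
Definition touching W C : {set {set 'I_n}} :=
  edges_in (vertex_pairs n) W :\: edges_in (vertex_pairs n) (W :\: C).

Lemma mem_edges_in G W e : (e \in edges_in G W) = (e \in G) && (e \subset W).
Proof. by rewrite inE. Qed.

Lemma set2_sub u v W : ([set u; v] \subset W) = (u \in W) && (v \in W).
Proof. by rewrite subUset !sub1set. Qed.

Lemma adj_edges_in G W u v :
  adj (edges_in G W) u v = [&& adj G u v, u \in W & v \in W].
Proof. by rewrite /adj mem_edges_in set2_sub. Qed.

Lemma component_closed W G C u v : is_component W G C ->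
  u \in C -> connect (adj (edges_in G W)) u v -> v \in C.
Proof.
case/and4P=> _ CW _ /forall_inP cl uC /connectP[s].
elim: s u uC => [|w s IH] u uC /=; first by move=> _ ->.
case/andP=> uw; apply: IH.
have /implyP : ([set u; w] :&: C != set0) ==> ([set u; w] \subset C) by apply: cl.
rewrite set2_sub => /(_ _)/andP[] //.
by apply/set0Pn; exists u; rewrite !inE eqxx.
Qed.

Lemma component_connect W G C u v : is_component W G C ->
  u \in C -> v \in C -> connect (adj (edges_in G W)) u v.
Proof.
case/and4P=> _ CW /forall_inP co _ uC vC.
have /forall_inP/(_ v vC) := co u uC.
apply: connect_sub => x y xy; apply: connect1; move: xy.
rewrite !adj_edges_in => /and3P[-> xC yC].
by rewrite (subsetP CW x xC) (subsetP CW y yC).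
Qed.

Lemma component_eq W G C D u : is_component W G C -> is_component W G D ->
  u \in C -> u \in D -> C = D.
Proof.
move=> cC cD uC uD; apply/setP => v; apply/idP/idP => ?.
  exact: component_closed cD uD (component_connect cC uC _).
exact: component_closed cC uC (component_connect cD uD _).
Qed.

(** This is what makes peeling work: once C is removed, the other components
    survive unchanged. *)
Lemma component_setD W G C D : is_component W G C -> is_component W G D ->
  D != C -> is_component (W :\: C) G D.
Proof.
move=> cC cD DC.
have DWC : D \subset W :\: C.
  rewrite subsetD disjoint_subset; case/and4P: (cD) => _ -> _ _ /=.
  apply/subsetP => u uD; rewrite inE; apply: contraNN DC => uC.
  by rewrite (component_eq cC cD uC uD).
case/and4P: cD => D0 DW co /forall_inP cl; apply/and4P; split => //.
apply/forall_inP => e; rewrite mem_edges_in => /andP[eG eWC].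
by apply: cl; rewrite mem_edges_in eG (subset_trans eWC) ?subsetDl.
Qed.

Lemma edges_in_touching G W C : G \subset vertex_pairs n -> C \subset W ->
  edges_in (G :&: touching W C) C = edges_in G C.
Proof.
move=> GV CW; apply/setP => e; rewrite !mem_edges_in !inE.
case eC: (e \subset C); rewrite ?andbF //.
case eG: (e \in G) => //=.
have := subsetP GV e eG; rewrite inE => e2.
rewrite e2 (subset_trans eC CW) /= !andbT subsetD (subset_trans eC CW) /=.
rewrite -setI_eq0 (setIidPl eC) -cards_eq0.
by move: e2 => /eqP ->.
Qed.

Lemma is_component_touching G W C : G \subset vertex_pairs n ->
  is_component W G C = is_component W (G :&: touching W C) C.
Proof.
move=> GV; rewrite /is_component; case: eqP => //= _.
case CW: (C \subset W) => //=; rewrite /connected_on edges_in_touching //.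
congr (_ && _); apply/forall_inP/forall_inP => cl e.
  rewrite mem_edges_in inE => /andP[/andP[eG _] eW].
  by apply: cl; rewrite mem_edges_in eG.
rewrite mem_edges_in => /andP[eG eW]; apply/implyP => eC.
apply: (implyP (cl e _)) => //.
rewrite mem_edges_in eW andbT inE eG /= !inE eW.
have := subsetP GV e eG; rewrite inE => ->.
by rewrite subsetD eW -setI_eq0 eC.
Qed.

Lemma component_touching G W C : G \subset vertex_pairs n ->
  is_component W G C -> G :&: touching W C = edges_in G C.
Proof.
move=> GV /and4P[C0 CW _ /forall_inP cl]; apply/setP => e.
rewrite mem_edges_in !inE; case eG: (e \in G) => //=.
have := subsetP GV e eG; rewrite inE => e2; rewrite e2 /=.
case eC: (e \subset C).
  rewrite (subset_trans eC CW) andbT subsetD (subset_trans eC CW) /=.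
  by rewrite -setI_eq0 (setIidPl eC) -cards_eq0; move: e2 => /eqP ->.
apply/negbTE; rewrite negb_and negbK.
case eW: (e \subset W); last by rewrite orbT.
rewrite orbF subsetD eW -setI_eq0 /=; apply/contraFT: eC.
by move=> h; apply: (implyP (cl e _)) => //; rewrite mem_edges_in eG.
Qed.

Lemma edges_in_disjoint_touching G W C : C \subset W ->
  edges_in (G :\: touching W C) (W :\: C) = edges_in G (W :\: C).
Proof.
move=> CW; apply/setP => e; rewrite !mem_edges_in !inE.
case eWC: (e \subset W :\: C); rewrite ?andbF //= !andbT.
by case: (e \in G) (#|e| == 2) => [] [].
Qed.

Lemma card_touching W C : C \subset W ->
  #|touching W C| = ('C(#|W|, 2) - 'C(#|W| - #|C|, 2))%N.
Proof.
move=> CW; rewrite /touching.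
have cardE S : #|edges_in (vertex_pairs n) S| = 'C(#|S|, 2).
  rewrite -cards_draws; apply: eq_card => e; rewrite !inE andbC //.
rewrite cardsDS ?cardE ?(cardsDS CW) //.
apply/subsetP => e; rewrite !inE => /andP[-> /subset_trans]; apply.
exact: subsetDl.
Qed.

(** Grow a subset of C one vertex at a time from a single vertex: connectivity
    supplies an edge leaving the current subset, and each new vertex brings one
    edge. *)
Lemma connected_edges G C : connected_on G C -> (#|C| <= #|edges_in G C| + 1)%N.
Proof.
move=> /forall_inP co; have [->|[u uC]] := set_0Vmem C; first by rewrite cards0.
suff grow m : (m < #|C|)%N -> exists S, [/\ u \in S, S \subset C, #|S| = m.+1 &
    (m <= #|edges_in G S|)%N].
  have C1 : (0 < #|C|)%N by apply/card_gt0P; exists u.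
  have [|S [uS SC cS eS]] := grow #|C|.-1; first by rewrite prednK.
  have SE : S = C by apply/eqP; rewrite eqEcard SC cS (prednK C1) leqnn.
  by rewrite SE in eS; rewrite addn1 -(prednK C1).
elim: m => [_|m IH mC].
  by exists [set u]; rewrite set11 sub1set cards1.
have [S [uS SC cS eS]] := IH (ltnW mC).
have [v vC vS] : exists2 v, v \in C & v \notin S.
  by apply/subsetPn; apply: contraTN mC => /subset_leq_card; rewrite cS -leqNgt.
have [x [y [xS yS xy]]] : exists x y, [/\ x \in S, y \notin S & adj (edges_in G C) x y].
  have /forall_inP/(_ v vC)/connectP[s] := co u uC.
  have : u \in S by [].
  elim: s {1 2 3}u => [|w s IHs] x xS /=; first by move=> _ E; rewrite E xS in vS.
  case/andP=> xw ps ls; case wS: (w \in S); first exact: IHs wS ps ls.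
  by exists x, w; rewrite wS.
move: xy; rewrite adj_edges_in => /and3P[xy xC yC].
exists (y |: S); split.
- by rewrite !inE uS orbT.
- by rewrite subUset sub1set yC.
- by rewrite cardsU1 yS cS.
apply: leq_ltn_trans eS (proper_card _); apply/properP; split.
  apply/subsetP => e; rewrite !mem_edges_in => /andP[-> eS] /=.
  by rewrite (subset_trans eS) ?subsetUr.
exists [set x; y]; rewrite mem_edges_in set2_sub.
  by rewrite !inE xS eqxx orbT /= andbT; exact: xy.
by rewrite (negbTE yS) !andbF.
Qed.

Lemma components_is_component G C : G \subset vertex_pairs n ->
  C \in components G -> is_component [set: 'I_n] G C.
Proof.
move=> GV; have adjC : connect_sym (adj G).
  by apply: sym_connect_sym => x y; rewrite /adj setUC.
case/imsetP=> u _ ->.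
have inC v : (v \in [set y in [set: 'I_n] | connect (adj G) u y]) = connect (adj G) u v.
  by rewrite !inE.
set C0 := [set y in _ | _] in inC *.
have inside v : connect (adj G) u v -> connect (adj (edges_in G C0)) u v.
  case/connectP => s ps ->; elim/last_ind: s ps => [|s y IH]; first by rewrite connect0.
  rewrite rcons_path last_rcons => /andP[ps sy].
  apply: connect_trans (IH ps) (connect1 _).
  have us : connect (adj G) u (last u s) by apply/connectP; exists s.
  by rewrite adj_edges_in sy !inC us (connect_trans us (connect1 sy)).
have adjC0 : connect_sym (adj (edges_in G C0)).
  by apply: sym_connect_sym => x y; rewrite /adj setUC.
apply/and4P; split.
- by apply/set0Pn; exists u; rewrite inC connect0.
- exact: subsetT.
- apply/forall_inP => x; rewrite inC => ux; apply/forall_inP => y; rewrite inC => uy.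
  by apply: connect_trans (inside _ uy); rewrite adjC0; apply: inside.
apply/forall_inP => e; rewrite mem_edges_in => /andP[eG _]; apply/implyP.
case/set0Pn=> x; rewrite inE inC => /andP[xe ux].
have := subsetP GV e eG; rewrite inE => /cards2P[y [z [yz E]]].
have yzG : adj G y z by rewrite /adj -E.
have zyG : adj G z y by rewrite /adj setUC -E.
rewrite E set2_sub !inC; move: xe; rewrite E !inE => /orP[]/eqP xE.
  by rewrite -xE ux (connect_trans ux) // xE connect1.
by rewrite -xE ux andbT (connect_trans ux) // xE connect1.
Qed.

End GraphComponents.

(** * Means and factorial moments of the number of good components *)

Section ComponentCounts.
Variables (R : realType) (n : nat).
Implicit Types (C D S W : {set 'I_n}) (G H : {set {set 'I_n}}) (u v w : 'I_n).
Implicit Types (p d A : R) (Q : nat -> nat -> bool).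

Local Notation E p := (expect p (vertex_pairs n)).

Lemma gnp_expectE p f : gnp_expect p f = E p f.
Proof.
apply: eq_bigr => G GV; congr (_ * _).
rewrite /gnp_prob /subset_weight (big_setID G) /= (setIidPr GV); congr (_ * _).
  by rewrite -prodr_const; apply: eq_bigr => e ->.
by rewrite -prodr_const; apply: eq_bigr => e; rewrite inE => /andP[/negbTE ->].
Qed.

(** A self-avoiding path from u never returns to u after its first edge, so the
    rest of it does not depend on the edges at u. *)
Lemma connect_first_step G W u v : u \in W -> connect (adj (edges_in G W)) u v ->
  v != u -> exists2 w, w \in W :\ u &
    adj G u w && connect (adj (edges_in G (W :\ u))) w v.
Proof.
move=> uW /connectP[s0 ps0 ->]; case/shortenP: ps0 => -[|w s] /=; first by rewrite eqxx.
rewrite adj_edges_in => /andP[/and3P[uw _ wW] ps] /andP[us uniqs] _ _.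
have wu : w != u by apply: contraNneq us => ->; rewrite inE eqxx.
exists w; first by rewrite !inE wu.
rewrite uw; apply/connectP; exists s => //.
elim: s w wu wW us ps {uw uniqs} => //= x s IH w wu wW us.
rewrite adj_edges_in => /andP[/and3P[wx _ xW] ps].
have xu : x != u by apply: contraNneq us => ->; rewrite !inE eqxx orbT.
rewrite adj_edges_in wx !inE wu wW xu xW /=; apply: IH => //.
by apply: contraNN us; rewrite !inE => /orP[->|->]; rewrite ?orbT.
Qed.

Lemma cluster_size_step G W u : u \in W ->
  \sum_(v in W) (connect (adj (edges_in G W)) u v)%:R <=
  1 + \sum_(w in W :\ u) (adj G u w)%:R *
        \sum_(v in W :\ u) (connect (adj (edges_in G (W :\ u))) w v)%:R :> R.
Proof.
move=> uW; rewrite (big_setD1 u) //= connect0 lerD2l.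
under [leRHS]eq_bigr do rewrite mulr_sumr.
rewrite exchange_big /=; apply: ler_sum => v; rewrite !inE => /andP[vu vW].
case uv: (connect _ u v); last first.
  by apply: sumr_ge0 => w _; rewrite mulr_ge0 ?ler0n.
have [w wW /andP[uw wv]] := connect_first_step uW uv vu.
rewrite (bigD1 w) //= uw wv mulr1 lerDl.
by apply: sumr_ge0 => x _; rewrite mulr_ge0 ?ler0n.
Qed.

Lemma expect_adj p u w : 0 <= p <= 1 -> u != w ->
  E p (fun G => (adj G u w)%:R) = p.
Proof.
move=> p01 uw.
have uwV : [set [set u; w]] \subset vertex_pairs n.
  by rewrite sub1set inE cards2 uw.
rewrite (expect_restrict p uwV) => [|G _]; last by rewrite /adj !inE eqxx andbT.
by rewrite expect_set1 /adj set11 inE mulr1 mulr0 addr0.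
Qed.

(** Let X(W) be the largest mean cluster size on W.  The first step of a
    self-avoiding path gives X(W) <= 1 + |W| p X(W minus a point), and 1 / d
    is stable under this recursion when |W| p <= 1 - d. *)
Lemma mean_cluster_size p d W u : 0 <= p <= 1 -> 0 < d ->
    #|W|%:R * p <= 1 - d -> u \in W ->
  \sum_(v in W) E p (fun G => (connect (adj (edges_in G W)) u v)%:R) <= d^-1.
Proof.
move=> p01 d0; have [m] := ubnP #|W|; elim: m W u => // m IH W u Wm Wp uW.
have Wc : #|W| = #|W :\ u|.+1 by rewrite (cardsD1 u) uW.
have p0 : 0 <= p by case/andP: p01.
rewrite -expect_sum; apply: le_trans (le_expect _ _) _ => //.
  by move=> G _; exact: cluster_size_step uW.
rewrite expectD expect_cst // expect_sum.
have step w : w \in W :\ u ->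
    E p (fun G => (adj G u w)%:R *
        \sum_(v in W :\ u) (connect (adj (edges_in G (W :\ u))) w v)%:R) <= p * d^-1.
  move=> wW; have uw : u != w by move: wW; rewrite !inE eq_sym => /andP[].
  have uwV : [set [set u; w]] \subset vertex_pairs n.
    by rewrite sub1set inE cards2 uw.
  rewrite (expect_indep p uwV).
  - rewrite expect_adj // ler_wpM2l // expect_sum IH //; first by rewrite -Wc in Wm *.
    by apply: le_trans Wp; rewrite ler_wpM2r // ler_nat Wc.
  - by move=> G _; rewrite /adj !inE eqxx andbT.
  move=> G _; apply: eq_bigr => v _; congr (nat_of_bool _)%:R.
  apply: eq_connect => x y; rewrite !adj_edges_in /adj !inE.
  case: (x =P u) => [->|/eqP xu] /=; first by rewrite !andbF.
  case: (y =P u) => [->|/eqP yu] /=; first by rewrite !andbF.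
  congr (_ && _); rewrite andb_idl // => _; apply/eqP => /setP/(_ u).
  by rewrite !inE eqxx !(eq_sym u) (negbTE xu) (negbTE yu).
apply: le_trans (lerD (lexx _) (ler_sum _ step)) _.
rewrite sumr_const -mulr_natl mulrA.
have : #|W :\ u|%:R * p <= 1 - d.
  by apply: le_trans Wp; rewrite ler_wpM2r // ler_nat Wc.
rewrite -(@ler_pM2r _ d^-1) ?invr_gt0 // mulrBl mul1r mulfV ?gt_eqF //; lra.
Qed.

(** Q tests the number of vertices and the number of edges of the component. *)
Definition good_component Q W G C :=
  is_component W G C && Q #|C| #|edges_in G C|.

Definition num_good Q W G : nat := #|[set C | good_component Q W G C]|.

Lemma num_goodE Q W G :
  (num_good Q W G)%:R = \sum_(C : {set 'I_n}) (good_component Q W G C)%:R :> R.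
Proof.
rewrite /num_good -sum1_card natr_sum big_mkcond; apply: eq_bigr => C _.
by rewrite inE; case: good_component.
Qed.

Lemma good_component_touching Q W G C : G \subset vertex_pairs n ->
  good_component Q W G C = good_component Q W (G :&: touching W C) C.
Proof.
move=> GV; rewrite /good_component -is_component_touching //.
case cC: (is_component W G C) => //=; rewrite edges_in_touching //.
by case/and4P: cC.
Qed.

(** A component with k vertices contributes k^2 connected pairs, and distinct
    components contribute disjoint sets of pairs. *)
Lemma num_good_size Q A W G : 0 <= A ->
    (forall k e, Q k e -> A <= k%:R) ->
  (num_good Q W G)%:R * A ^+ 2 <=
  \sum_(u in W) \sum_(v in W) (connect (adj (edges_in G W)) u v)%:R.
Proof.
move=> A0 QA; rewrite num_goodE mulr_suml.
apply: (@le_trans _ _ (\sum_(C : {set 'I_n}) \sum_(u in W) \sum_(v in W)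
    [&& good_component Q W G C, u \in C & v \in C]%:R)).
  apply: ler_sum => C _; case gC: good_component; last first.
    by rewrite mul0r; apply: sumr_ge0 => u _; apply: sumr_ge0 => v _; exact: ler0n.
  case/andP: gC => /and4P[_ CW _ _] /QA AC; rewrite mul1r.
  have CE (f : 'I_n -> R) : \sum_(u in C) f u = \sum_(u in W) (u \in C)%:R * f u.
    rewrite [RHS]big_mkcond [LHS]big_mkcond; apply: eq_bigr => u _.
    case uC: (u \in C); rewrite ?mul1r ?mul0r; last by case: ifP.
    by rewrite (subsetP CW).
  have -> : \sum_(u in W) \sum_(v in W) [&& true, u \in C & v \in C]%:R =
      \sum_(u in C) \sum_(v in C) 1 :> R.
    rewrite CE; apply: eq_bigr => u _; rewrite CE mulr_sumr; apply: eq_bigr => v _.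
    by case: (u \in C) (v \in C) => [] []; rewrite ?mulr0 ?mul1r ?mul0r.
  by rewrite !sumr_const -mulr_natr expr2 ler_pM.
rewrite exchange_big; apply: ler_sum => u uW.
rewrite exchange_big; apply: ler_sum => v vW /=.
have [C /and3P[/andP[cC _] uC vC]|no] :=
    pickP (fun C => [&& good_component Q W G C, u \in C & v \in C]); last first.
  by rewrite big1 // => C _; rewrite no.
rewrite (component_connect cC uC vC). rewrite (bigD1 C) //= big1 => [|D DC].
  by rewrite addr0; case: (_ && _); rewrite ?ler01.
case gD: [&& _, _ & _] => //; case/and3P: gD => /andP[cD _] uD _.
by rewrite (component_eq cD cC uD uC) eqxx in DC.
Qed.

(** With A of order n^(2/3) and d of order n^(-1/3) the bound on the mean number
    is of order one, the correct order in the critical window. *)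
Lemma mean_num_good_subcritical Q A p d W : 0 <= p <= 1 -> 0 < d ->
    #|W|%:R * p <= 1 - d -> 0 <= A -> (forall k e, Q k e -> A <= k%:R) ->
  E p (fun G => (num_good Q W G)%:R) * A ^+ 2 <= #|W|%:R / d.
Proof.
move=> p01 d0 Wp A0 QA; rewrite mulrC -expectZ.
apply: le_trans (le_expect _ _) _ => //.
  by move=> G _; rewrite mulrC; exact: num_good_size A0 QA.
rewrite expect_sum mulr_natl -sumr_const; apply: ler_sum => u uW.
by rewrite expect_sum; exact: mean_cluster_size.
Qed.

(** Whether C is good is decided by the T pairs of [touching W C], and when it is
    good the edges among them are exactly those inside C.  Hence a pointwise
    comparison of the weights of e edges among T pairs is enough. *)
Lemma mean_num_good_change Q p0 p c W : 0 <= p0 <= 1 -> 0 <= p <= 1 ->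
    (forall k e, let T := ('C(#|W|, 2) - 'C(#|W| - k, 2))%N in
      Q k e -> (0 < k <= #|W|)%N -> (k <= e + 1)%N -> (e <= T)%N ->
      p ^+ e * (1 - p) ^+ (T - e) <= c * (p0 ^+ e * (1 - p0) ^+ (T - e))) ->
  E p (fun G => (num_good Q W G)%:R) <= c * E p0 (fun G => (num_good Q W G)%:R).
Proof.
move=> p001 p01 le.
rewrite (eq_expect _ (fun G _ => num_goodE Q W G)).
rewrite (eq_expect p0 (fun G _ => num_goodE Q W G)).
rewrite !expect_sum mulr_sumr; apply: ler_sum => C _.
have TV : touching W C \subset vertex_pairs n.
  by apply/subsetP => e; rewrite !inE => /andP[_ /andP[]].
have restr p' : 0 <= p' <= 1 -> E p' (fun G => (good_component Q W G C)%:R) =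
    expect p' (touching W C) (fun G => (good_component Q W G C)%:R).
  by move=> p'01; apply: expect_restrict => // G GV; rewrite {1}good_component_touching.
rewrite !restr // /expect mulr_sumr; apply: ler_sum => G GT.
case gC: good_component; rewrite ?mulr0 ?mulr1 //.
case/andP: gC => cC QC; have GV := subset_trans GT TV.
case/and4P: (cC) => C0 CW co _.
have GE : edges_in G C = G by rewrite -(component_touching GV cC) (setIidPl GT).
rewrite /subset_weight cardsDS // card_touching // -[#|G|]/(#|pred_of_set G|).
rewrite GE in QC; apply: le => //.
- by rewrite card_gt0 C0 subset_leq_card.
- by have := connected_edges co; rewrite GE.
by rewrite -card_touching // subset_leq_card.
Qed.

Lemma leq_ffactn a b q : (a <= b)%N -> (a ^_ q <= b ^_ q)%N.
Proof.
elim: q a b => [|q IH] a b ab; first by rewrite !ffactn0.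
by rewrite !ffactnS leq_mul // IH // -!subn1 leq_sub2r.
Qed.

Lemma ffact_num_good_rec Q W G q :
  ((num_good Q W G) ^_ q.+1)%:R <=
  \sum_(C : {set 'I_n}) (good_component Q W G C)%:R *
     ((num_good Q (W :\: C) G) ^_ q)%:R :> R.
Proof.
rewrite ffactnS natrM num_goodE mulr_suml; apply: ler_sum => C _.
case gC: good_component; rewrite ?mul0r ?mul1r // ler_nat leq_ffactn //.
rewrite /num_good (cardsD1 C) inE gC /=; apply/subset_leq_card/subsetP => D.
rewrite !inE => /andP[DC /andP[cD QD]].
by rewrite /good_component QD andbT (component_setD _ cD DC) //; case/andP: gC.
Qed.

Lemma good_component_disjoint_touching Q W G C D : C \subset W ->
  good_component Q (W :\: C) (G :\: touching W C) D =
  good_component Q (W :\: C) G D.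
Proof.
move=> CW; rewrite /good_component /is_component /connected_on edges_in_disjoint_touching //.
case DWC: (D \subset W :\: C); rewrite ?andbF //.
have -> : edges_in (G :\: touching W C) D = edges_in G D => //.
have := edges_in_disjoint_touching G CW; move/setP => EE; apply/setP => e.
have := EE e; rewrite !mem_edges_in; case eD: (e \subset D); rewrite ?andbF //.
by rewrite (subset_trans eD DWC).
Qed.

Lemma mean_ffact_num_good_rec Q p W q : 0 <= p <= 1 ->
  E p (fun G => ((num_good Q W G) ^_ q.+1)%:R) <=
  \sum_(C : {set 'I_n} | C \subset W) E p (fun G => (good_component Q W G C)%:R) *
     E p (fun G => ((num_good Q (W :\: C) G) ^_ q)%:R).
Proof.
move=> p01; apply: le_trans (le_expect _ _) _ => //.
  by move=> G _; exact: ffact_num_good_rec.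
rewrite expect_sum [leRHS]big_mkcond; apply: ler_sum => C _; case: ifP => CW; last first.
  rewrite (@eq_expect _ _ p _ _ (fun=> 0)) ?expect_cst // => G _.
  by rewrite /good_component /is_component CW /= andbF mul0r.
have TV : touching W C \subset vertex_pairs n.
  by apply/subsetP => e; rewrite !inE => /andP[_ /andP[]].
rewrite (expect_indep p TV) // => G GV; first by rewrite {1}good_component_touching.
congr (_ ^_ _)%:R; apply: eq_card => D; rewrite !inE.
by rewrite good_component_disjoint_touching.
Qed.

(** Iterates the peeling step: each of the components removed so far has at least A
    vertices, so the i-th factor sees a vertex set of size at most N - i A. *)
Lemma mean_ffact_num_good Q p A (N : R) (M : nat -> R) q j W :
    0 <= p <= 1 -> (forall k e, Q k e -> A <= k%:R) -> (forall i, 0 <= M i) ->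
    (forall i S, #|S|%:R + i%:R * A <= N -> E p (fun G => (num_good Q S G)%:R) <= M i) ->
    #|W|%:R + j%:R * A <= N ->
  E p (fun G => ((num_good Q W G) ^_ q)%:R) <= \prod_(i < q) M (j + i)%N.
Proof.
move=> p01 QA M0 QM; elim: q j W => [|q IH] j W WN.
  by rewrite big_ord0 (@eq_expect _ _ p _ _ (fun=> 1)) ?expect_cst.
apply: le_trans (mean_ffact_num_good_rec _ _ _ p01) _.
rewrite big_ord_recl addn0.
set P := \prod_(i < q) _; have P0 : 0 <= P by apply: prodr_ge0.
apply: le_trans (ler_wpM2r P0 (QM _ _ WN)).
rewrite (eq_expect p (fun G _ => num_goodE Q W G)) expect_sum mulr_suml.
rewrite [leRHS](bigID (fun C : {set 'I_n} => C \subset W)) /=.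
apply: ler_wpDr; first by apply: sumr_ge0 => C _; rewrite mulr_ge0 ?expect_ge0.
apply: ler_sum => C CW; have [AC|CA] := leP A #|C|%:R.
  rewrite ler_wpM2l ?expect_ge0 //.
  have -> : P = \prod_(i < q) M (j.+1 + i)%N.
    by apply: eq_bigr => i _; rewrite /= /bump add1n addnS.
  apply: IH; apply: le_trans WN; rewrite cardsDS // natrB ?subset_leq_card //.
  rewrite -natr1 mulrDl mul1r; lra.
rewrite (@eq_expect _ _ p _ _ (fun=> 0)) ?expect_cst ?mul0r // => G _.
rewrite /good_component; case QC: (Q _ _); rewrite ?andbF //.
by move: (QA _ _ QC); rewrite leNgt CA.
Qed.

End ComponentCounts.

(** * Comparison of two edge densities *)

Section DensityRatio.
Variable R : realType.
Implicit Types (p eta h d : R) (k e w s m : nat).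

(** The quadratic term is the source of the decay in q: halving the exponent and
    squaring 1 - y / 2 <= exp (- y / 2) keeps enough of it. *)
Lemma one_sub_le_expR h : 0 <= h <= 1 -> 1 - h <= expR (- h - h ^+ 2 / 4).
Proof.
move=> /andP[h0 h1]; set y := h + h ^+ 2 / 4.
have -> : - h - h ^+ 2 / 4 = 2%:R * (- (y / 2)) by rewrite /y; field.
rewrite expRM_natl; have y1 : 0 <= 1 - y / 2 by rewrite /y; nra.
have : (1 - y / 2) ^+ 2 <= expR (- (y / 2)) ^+ 2.
  by rewrite ler_sqr ?nnegrE ?expR_ge0 // expR_ge1Dx.
apply: le_trans; rewrite /y.
have -> : (1 - (h + h ^+ 2 / 4) / 2) ^+ 2 = 1 - h + h ^+ 3 / 8 + h ^+ 4 / 64 by field.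
by rewrite -addrA lerDl addr_ge0 // divr_ge0 // exprn_ge0.
Qed.

Lemma natr_bin2 m : ('C(m, 2))%:R = m%:R * (m%:R - 1) / 2 :> R.
Proof.
elim: m => [|m IH]; first by rewrite bin0n mul0r mul0r.
by rewrite binS bin1 natrD IH -natr1; field.
Qed.

Lemma natr_bin2_diff w k : (k <= w)%N ->
  ('C(w, 2) - 'C(w - k, 2))%:R = k%:R * w%:R - k%:R * (k%:R + 1) / 2 :> R.
Proof.
move=> kw; rewrite natrB ?leq_bin2l ?leq_subr // !natr_bin2 natrB //; by field.
Qed.

Lemma lerXn_expR m (y c t : R) : 0 <= y -> y <= c * expR t ->
  y ^+ m <= c ^+ m * expR (m%:R * t).
Proof. by move=> y0 yc; rewrite expRM_natl -exprMn lerXn2r ?nnegrE // (le_trans y0). Qed.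

(** Decreasing the density.  The edges contribute exp (- e (h + h^2 / 4)), the
    non-edges at most exp ((e + 2) h) because T p0 is at most about k <= e + 1; the linear
    terms cancel and the quadratic one stays. *)
Lemma density_ratio_le p0 p k e w d h :
    let T := ('C(w, 2) - 'C(w - k, 2))%N in
    0 <= p -> 0 < p0 < 1 -> w%:R * p0 = 1 - d -> 0 <= d -> 0 <= h -> p = p0 * (1 - h) ->
    (0 < k <= w)%N -> (k <= e + 1)%N -> (e <= T)%N ->
  p ^+ e * (1 - p) ^+ (T - e) <=
    expR (2 - e%:R * h ^+ 2 / 4) * (p0 ^+ e * (1 - p0) ^+ (T - e)).
Proof.
move=> T p_ge0 /andP[p0_gt0 p0_lt1] wp0 d0 h0 pE /andP[k0 kw] ke eT.
have h1 : h <= 1 by move: p_ge0; rewrite pE pmulr_rge0 // subr_ge0.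
have q0 : 0 < 1 - p0 by rewrite subr_gt0.
have pe : p ^+ e <= p0 ^+ e * expR (e%:R * (- h - h ^+ 2 / 4)).
  by apply: lerXn_expR; rewrite // pE ler_pM2l // one_sub_le_expR ?h0.
have p1 : 0 <= 1 - p by rewrite pE; nra.
have pm : (1 - p) ^+ (T - e) <=
    (1 - p0) ^+ (T - e) * expR ((T - e)%:R * (p0 * h / (1 - p0))).
  apply: lerXn_expR => //; apply: le_trans (ler_wpM2l (ltW q0) (expR_ge1Dx _)).
  by rewrite mulrDr mulrCA mulfV ?gt_eqF // pE; lra.
apply: le_trans (ler_pM _ _ pe pm) _; rewrite ?exprn_ge0 //.
rewrite mulrACA -expRD mulrC ler_wpM2r ?mulr_ge0 ?exprn_ge0 ?(ltW p0_gt0) ?(ltW q0) //.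
rewrite ler_expR.
have kR : 1 <= k%:R :> R by rewrite ler1n.
have wR : k%:R <= w%:R :> R by rewrite ler_nat.
have keR : k%:R <= e%:R + 1 :> R by rewrite natr1 ler_nat -addn1.
have Tp0 : T%:R * p0 + 2 * p0 <= k%:R + 1.
  rewrite natr_bin2_diff //.
  have : k%:R * (w%:R * p0) <= k%:R by rewrite wp0; nra.
  have : p0 <= 1 by lra.
  have : p0 * (k%:R * (k%:R + 1)) >= p0 * 2 by rewrite ler_pM2l //; nra.
  by lra.
have main : (T - e)%:R * (p0 / (1 - p0)) <= e%:R + 2.
  rewrite mulrA ler_pdivrMr // natrB //; nra.
have : (T - e)%:R * (p0 * h / (1 - p0)) <= h * (e%:R + 2).
  have -> : (T - e)%:R * (p0 * h / (1 - p0)) = h * ((T - e)%:R * (p0 / (1 - p0))).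
    by field; rewrite gt_eqF.
  by rewrite ler_wpM2l.
by nra.
Qed.

(** Increasing the density.  Here an upper bound on e is essential: the linear
    term is eta (e - T p0) up to a bounded multiple of eta, and T p0 falls
    short of k only by k d + k^2 / w. *)
Lemma density_ratio_ge p0 p k e w s d eta :
    let T := ('C(w, 2) - 'C(w - k, 2))%N in
    p <= 1 -> 0 < p0 < 1 -> w%:R * p0 = 1 - d -> 0 <= d -> 0 <= eta -> p = p0 * (1 + eta) ->
    (0 < k <= w)%N -> (e + 1 <= k + s)%N -> (e <= T)%N ->
  p ^+ e * (1 - p) ^+ (T - e) <=
    expR (eta * (2 * s%:R + k%:R * d + k%:R ^+ 2 / w%:R)) *
    (p0 ^+ e * (1 - p0) ^+ (T - e)).
Proof.
move=> T p_le1 /andP[p0_gt0 p0_lt1] wp0 d0 eta0 pE /andP[k0 kw] eks eT.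
have q0 : 0 < 1 - p0 by rewrite subr_gt0.
have p_ge0 : 0 <= p by rewrite pE; nra.
have pe : p ^+ e <= p0 ^+ e * expR (e%:R * eta).
  by apply: lerXn_expR; rewrite // pE ler_pM2l // expR_ge1Dx.
have pm : (1 - p) ^+ (T - e) <= (1 - p0) ^+ (T - e) * expR ((T - e)%:R * (- (p0 * eta))).
  apply: lerXn_expR; first by rewrite subr_ge0.
  apply: le_trans (ler_wpM2l (ltW q0) (expR_ge1Dx _)); rewrite pE.
  have : 0 <= p0 * p0 * eta by rewrite !mulr_ge0 // ltW.
  by lra.
apply: le_trans (ler_pM _ _ pe pm) _; rewrite ?exprn_ge0 ?subr_ge0 //.
rewrite mulrACA -expRD mulrC ler_wpM2r ?mulr_ge0 ?exprn_ge0 ?(ltW p0_gt0) ?(ltW q0) //.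
rewrite ler_expR.
have kR : 1 <= k%:R :> R by rewrite ler1n.
have wR : k%:R <= w%:R :> R by rewrite ler_nat.
have w0 : 0 < w%:R :> R by lra.
have eR : e%:R + 1 <= k%:R + s%:R :> R by rewrite natr1 -natrD ler_nat -addn1.
have s0 : 0 <= s%:R :> R by rewrite ler0n.
have Tp0 : k%:R - k%:R * d - k%:R ^+ 2 / w%:R <= T%:R * p0.
  rewrite natr_bin2_diff //.
  have p0E : p0 = (1 - d) / w%:R by rewrite -wp0 mulrC mulKf ?gt_eqF.
  have kk : k%:R * (k%:R + 1) / 2 * p0 <= k%:R ^+ 2 / w%:R.
    rewrite p0E mulrA ler_wpM2r ?invr_ge0 ?(ltW w0) //.
    have : 0 <= k%:R * (k%:R + 1) / 2 * d by rewrite !mulr_ge0 ?addr_ge0 ?invr_ge0 ?ler0n.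
    have : k%:R <= k%:R ^+ 2 :> R by rewrite expr2 ler_peMr ?ler0n.
    by lra.
  have -> : (k%:R * w%:R - k%:R * (k%:R + 1) / 2) * p0 =
      k%:R * (w%:R * p0) - k%:R * (k%:R + 1) / 2 * p0 by ring.
  by rewrite wp0; lra.
have ep0 : e%:R * p0 <= 1 + s%:R.
  have : e%:R * p0 <= (w%:R + s%:R) * p0 by rewrite ler_wpM2r ?(ltW p0_gt0) //; lra.
  by nra.
have -> : e%:R * eta + (T - e)%:R * - (p0 * eta) = eta * (e%:R + e%:R * p0 - T%:R * p0).
  by rewrite natrB //; ring.
by rewrite ler_wpM2l //; lra.
Qed.

End DensityRatio.

(** * First moments in the critical window *)

Section CriticalWindow.
Variable R : realType.
Implicit Types (x y p a b L : R) (n s i q k e : nat).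

Definition window (lo hi : R) s k e : bool :=
  [&& lo <= k%:R, k%:R <= hi & (e + 1 <= k + s)%N].

(** The first summand bounds the exponent of [density_ratio_ge] in the window;
    the other two absorb the additive error of [density_ratio_le] and the
    finitely many i with i a < 2 L + 1, for which there is no decay. *)
Definition tilt_cost a b L s : R :=
  (2 * L + 1) * (2 * s%:R + b / 2 + 2 * b ^+ 2 * (1 + L)) +
  3 + a * (2 * L + 1) ^+ 2 / 16.

Definition window_cst a b L s : R := 2 / a ^+ 2 * expR (tilt_cost a b L s).

(** The two comparisons of densities, for the reference mean degree
    w p0 = 1 - 1 / (2 x).  When p <= p0 the gain is a^3 i^2 / 16 as soon as
    i a > 2 L + 1; when p > p0 then 2 i a <= 2 L + 1, and a^3 i^2 / 16 is bounded. *)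
Lemma window_density_ratio x p a b L s i w k e :
    let d := x^-1 / 2 in let p0 := (1 - d) / w%:R in
    let T := ('C(w, 2) - 'C(w - k, 2))%N in
    1 <= x -> 0 <= p <= 1 -> p * x ^+ 3 <= 1 + L / x ->
    0 < a -> 0 <= b -> 0 <= L -> w%:R + i%:R * (a * x ^+ 2) <= x ^+ 3 ->
    window (a * x ^+ 2) (b * x ^+ 2) s k e ->
    (0 < k <= w)%N -> (k <= e + 1)%N -> (e <= T)%N ->
  p ^+ e * (1 - p) ^+ (T - e) <=
    expR (tilt_cost a b L s - a ^+ 3 / 16 * i%:R ^+ 2) *
    (p0 ^+ e * (1 - p0) ^+ (T - e)).
Proof.
move=> d p0 T x1 /andP[p_ge0 p_le1] px a0 b0 L0 wx /and3P[ak kb eks] kw ke eT.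
have x0 : 0 < x by lra.
pose y := x^-1; have y0 : 0 < y by rewrite invr_gt0.
have y1 : y <= 1 by rewrite invf_le1.
have xy : x * y = 1 by rewrite mulfV ?gt_eqF.
have w1 : 1 <= w%:R :> R.
  by rewrite ler1n; case/andP: kw => k0 /(leq_trans k0).
have w0 : 0 < w%:R :> R by lra.
have dE : d = y / 2 by [].
have d0 : 0 < d by lra.
have wp0 : w%:R * p0 = 1 - d by rewrite mulrC divfK ?gt_eqF.
have p0_gt0 : 0 < p0 by rewrite divr_gt0 //; lra.
have p0_lt1 : p0 < 1 by rewrite ltr_pdivrMr //; lra.
set g := i%:R * a; have g0 : 0 <= g by rewrite mulr_ge0 ?ler0n ?ltW.
(* x^2 g is the number of vertices lost to the i peeled components; they make
   the remaining graph subcritical by (g - L) / x *)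
have wp : w%:R * p <= 1 - (g - L) * y.
  have wy : w%:R <= x ^+ 3 * (1 - g * y).
    have -> : x ^+ 3 * (1 - g * y) = x ^+ 3 - x ^+ 2 * g * (x * y) by ring.
    by rewrite xy /g; lra.
  have gy : 0 <= 1 - g * y.
    by rewrite -(pmulr_rge0 _ (exprn_gt0 3 x0)) (le_trans _ wy) ?ler0n.
  have : w%:R * p <= (p * x ^+ 3) * (1 - g * y).
    by rewrite mulrC -mulrA ler_wpM2l.
  have : (p * x ^+ 3) * (1 - g * y) <= (1 + L * y) * (1 - g * y) by rewrite ler_wpM2r.
  have : 0 <= L * y * (g * y) by rewrite !mulr_ge0 // ltW.
  by lra.
have cost0 : 0 <= (2 * L + 1) * (2 * s%:R + b / 2 + 2 * b ^+ 2 * (1 + L)).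
  rewrite mulr_ge0 ?addr_ge0 ?mulr_ge0 ?ler0n ?exprn_ge0 ?invr_ge0 ?ler0n //; lra.
have a3 : a ^+ 3 / 16 * i%:R ^+ 2 = a * g ^+ 2 / 16 by rewrite /g; ring.
have weight0 : 0 <= p0 ^+ e * (1 - p0) ^+ (T - e).
  by rewrite mulr_ge0 ?exprn_ge0 ?subr_ge0 // ltW.
have [pp0|p0p] := leP p p0.
  pose h := 1 - p / p0.
  have pE : p = p0 * (1 - h) by rewrite /h; field; rewrite gt_eqF.
  have h0 : 0 <= h by rewrite subr_ge0 ler_pdivrMr ?mul1r.
  have h1 : h <= 1 by rewrite lerBlDr lerDl divr_ge0 // ltW.
  apply: le_trans (density_ratio_le p_ge0 _ wp0 (ltW d0) h0 pE kw ke eT) _.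
    by rewrite p0_gt0.
  rewrite ler_wpM2r // ler_expR /tilt_cost a3.
  have hy : (g - L - 1 / 2) * y <= h.
    have : h * (1 - d) = 1 - d - w%:R * p by rewrite pE mulrA wp0; ring.
    have : 0 <= h * d by rewrite mulr_ge0 // ltW.
    by rewrite dE; lra.
  (* rescaled: e is about a x^2 and h is t / x, so e h^2 is about a t^2 *)
  pose t := h * x; have t0 : 0 <= t by rewrite mulr_ge0 // ltW.
  have tg : g - L - 1 / 2 <= t.
    have -> : g - L - 1 / 2 = (g - L - 1 / 2) * y * x.
      by rewrite -mulrA (mulrC y) xy mulr1.
    by rewrite ler_wpM2r // ltW.
  have gt2 : g ^+ 2 <= 4 * t ^+ 2 + (2 * L + 1) ^+ 2.
    have [gL|Lg] := leP g (2 * L + 1).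
      have : g ^+ 2 <= (2 * L + 1) ^+ 2 by rewrite ler_sqr ?nnegrE //; lra.
      by have := sqr_ge0 t; lra.
    have : (g / 2) ^+ 2 <= t ^+ 2 by rewrite ler_sqr ?nnegrE //; lra.
    by have := sqr_ge0 (2 * L + 1); lra.
  have eh : a * t ^+ 2 - 1 <= e%:R * h ^+ 2.
    have keR : k%:R <= e%:R + 1 :> R by rewrite natr1 ler_nat -addn1.
    have : (a * x ^+ 2) * h ^+ 2 <= (e%:R + 1) * h ^+ 2.
      by rewrite ler_wpM2r ?sqr_ge0 //; lra.
    have : h ^+ 2 <= 1 by rewrite expr_le1.
    by rewrite /t; lra.
  have : a * g ^+ 2 <= a * (4 * t ^+ 2 + (2 * L + 1) ^+ 2) by rewrite ler_pM2l.
  by lra.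
pose eta := p / p0 - 1.
have pE : p = p0 * (1 + eta) by rewrite /eta; field; rewrite gt_eqF.
have eta0 : 0 <= eta by rewrite subr_ge0 ler_pdivlMr ?mul1r // ltW.
apply: le_trans (density_ratio_ge p_le1 _ wp0 (ltW d0) eta0 pE kw eks eT) _.
  by rewrite p0_gt0.
rewrite ler_wpM2r // ler_expR /tilt_cost a3.
have etay : eta <= (2 * L + 1 - 2 * g) * y.
  have : eta * (1 - d) = w%:R * p - 1 + d by rewrite pE mulrA wp0; ring.
  have : eta * d <= eta / 2 by rewrite ler_wpM2l //; lra.
  by rewrite dE; lra.
have gL : 2 * g <= 2 * L + 1.
  by rewrite -subr_ge0 -(pmulr_lge0 _ y0) (le_trans eta0).
have g2 : a * g ^+ 2 <= a * (2 * L + 1) ^+ 2.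
  by rewrite ler_pM2l // ler_sqr ?nnegrE //; lra.
have etaL : eta <= (2 * L + 1) * y.
  have : 0 <= g * y by rewrite mulr_ge0 // ltW.
  by lra.
(* p0 < p forces w to be comparable with n, which controls k^2 / w *)
have wL : x ^+ 3 <= 2 * (1 + L) * w%:R.
  have : w%:R * p0 <= w%:R * p by rewrite ler_wpM2l // ltW.
  rewrite wp0 => /(ler_wpM2r (ltW (exprn_gt0 3 x0))).
  have : w%:R * (p * x ^+ 3) <= w%:R * (1 + L).
    rewrite ler_wpM2l ?(ltW w0) // (le_trans px) // lerD2l -/y.
    by rewrite ler_piMr.
  have : d * x ^+ 3 <= 1 / 2 * x ^+ 3.
    by rewrite ler_wpM2r ?exprn_ge0 ?(ltW x0) //; lra.
  by lra.
have kd : k%:R * d <= b / 2 * x.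
  have : k%:R * d <= b * x ^+ 2 * d by rewrite ler_wpM2r // ltW.
  have -> : b * x ^+ 2 * d = b / 2 * x * (x * y) by rewrite dE; ring.
  by rewrite xy mulr1.
have k2 : k%:R ^+ 2 / w%:R <= 2 * b ^+ 2 * (1 + L) * x.
  rewrite ler_pdivrMr //.
  have : k%:R ^+ 2 <= (b * x ^+ 2) ^+ 2 by rewrite ler_sqr ?nnegrE ?ler0n // (le_trans (ler0n _ k)).
  have : b ^+ 2 * x * x ^+ 3 <= b ^+ 2 * x * (2 * (1 + L) * w%:R).
    by rewrite ler_wpM2l // mulr_ge0 ?sqr_ge0 // ltW.
  by lra.
have sx : 2 * s%:R <= 2 * s%:R * x by rewrite ler_peMr // mulr_ge0 ?ler0n.
set B := 2 * s%:R + b / 2 + _.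
have B0 : 0 <= B.
  rewrite !addr_ge0 ?mulr_ge0 ?ler0n ?sqr_ge0 ?invr_ge0 ?ler0n //; lra.
have : eta * (2 * s%:R + k%:R * d + k%:R ^+ 2 / w%:R) <= eta * (x * B).
  by rewrite ler_wpM2l // /B; lra.
have : eta * (x * B) <= (2 * L + 1) * y * (x * B).
  by rewrite ler_wpM2r // mulr_ge0 // ltW.
have -> : (2 * L + 1) * y * (x * B) = (2 * L + 1) * B * (x * y) by ring.
rewrite xy mulr1; lra.
Qed.

Lemma window_cst_gt0 a b L s : 0 < a -> 0 < window_cst a b L s.
Proof. by move=> a0; rewrite mulr_gt0 ?divr_gt0 ?exprn_gt0 ?expR_gt0. Qed.

Lemma mean_num_good_window n x p a b L s i (W : {set 'I_n}) :
    1 <= x -> 0 <= p <= 1 -> p * x ^+ 3 <= 1 + L / x ->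
    0 < a -> 0 <= b -> 0 <= L -> #|W|%:R + i%:R * (a * x ^+ 2) <= x ^+ 3 ->
  expect p (vertex_pairs n)
    (fun G => (num_good (window (a * x ^+ 2) (b * x ^+ 2) s) W G)%:R) <=
  window_cst a b L s * expR (- (a ^+ 3 / 16) * i%:R ^+ 2).
Proof.
move=> x1 p01 px a0 b0 L0 Wx; set Q := window _ _ _.
have x0 : 0 < x by lra.
have A0 : 0 < a * x ^+ 2 by rewrite mulr_gt0 ?exprn_gt0.
have QA k e : Q k e -> a * x ^+ 2 <= k%:R by case/and3P.
(* p0 is meaningless on the empty set, where d = 1 makes the subcritical bound 0 *)
have [W0|W_gt0] := posnP #|W|.
  apply: (@le_trans _ _ 0); last by rewrite mulr_ge0 ?expR_ge0 ?ltW ?window_cst_gt0.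
  have := mean_num_good_subcritical (d := 1) (W := W) p01 ltr01 _ (ltW A0) QA.
  by rewrite W0 !mul0r subrr pmulr_lle0 ?exprn_gt0 //; apply.
pose d := x^-1 / 2; pose p0 := (1 - d) / #|W|%:R.
have w1 : 1 <= #|W|%:R :> R by rewrite ler1n.
have w0 : 0 < #|W|%:R :> R by lra.
have y1 : x^-1 <= 1 by rewrite invf_le1.
have d0 : 0 < d by rewrite divr_gt0 ?invr_gt0.
have p001 : 0 <= p0 <= 1.
  have d1 : d <= 1 by rewrite /d; lra.
  by rewrite divr_ge0 ?subr_ge0 ?ler0n //= ler_pdivrMr //; lra.
have Wp0 : #|W|%:R * p0 <= 1 - d by rewrite mulrC divfK ?gt_eqF.
have ratio := window_density_ratio x1 p01 px a0 b0 L0 Wx.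
have -> : window_cst a b L s * expR (- (a ^+ 3 / 16) * i%:R ^+ 2) =
    expR (tilt_cost a b L s - a ^+ 3 / 16 * i%:R ^+ 2) * (2 / a ^+ 2).
  by rewrite /window_cst mulNr expRD; ring.
apply: le_trans (mean_num_good_change p001 p01 _) _.
  by move=> k e; exact: ratio.
rewrite ler_wpM2l ?expR_ge0 //.
have := mean_num_good_subcritical p001 d0 Wp0 (ltW A0) QA.
rewrite -ler_pdivlMr ?exprn_gt0 // => /le_trans; apply.
rewrite !ler_pdivrMr ?exprn_gt0 //.
have -> : 2 / a ^+ 2 * (a * x ^+ 2) ^+ 2 * d = x ^+ 3.
  by rewrite /d; field; rewrite !gt_eqF.
apply: le_trans Wx; rewrite lerDl mulr_ge0 ?ler0n ?(ltW A0) //.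
Qed.

(** The induction step compares q^2 + 1 with ((q + 1)^3 - q^3) / 6; the
    constant 1 is what the factor expR c pays for. *)
Lemma prod_gaussian_le (c C : R) q : 0 <= c -> 0 <= C ->
  \prod_(i < q) (C * expR (- c * i%:R ^+ 2)) <=
  (C * expR c) ^+ q * expR (- (c / 6) * q%:R ^+ 3).
Proof.
move=> c0 C0; elim: q => [|q IH].
  by rewrite big_ord0 expr0 mul1r expr0n mulr0 expR0.
rewrite big_ord_recr /=.
apply: le_trans (ler_wpM2r _ IH) _; first by rewrite mulr_ge0 ?expR_ge0.
rewrite (exprSr _ q) -!mulrA ler_wpM2l ?exprn_ge0 ?mulr_ge0 ?expR_ge0 //.
rewrite mulrCA ler_wpM2l // -!expRD ler_expR -(natr1 q).
have : 0 <= c * (q%:R ^+ 2 / 2 - q%:R / 2 + 5 / 6).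
  by rewrite mulr_ge0 //; have := sqr_ge0 (q%:R - 1 / 2 : R); lra.
by lra.
Qed.

(** Falling factorials are monotone, so this carries moment bounds for the number of
    good components over to Xi. *)
Lemma Xi_le_num_good n (G : {set {set 'I_n}}) (K : set (R * nat))
    (Q : nat -> nat -> bool) : G \subset vertex_pairs n ->
    (forall C : {set 'I_n}, atom R G C \in K -> Q #|C| #|edges_in G C|) ->
  (Xi G K <= num_good Q [set: 'I_n] G)%N.
Proof.
move=> GV KQ; rewrite /num_good /Xi -sum1_card [leqRHS]big_mkcond [leqLHS]big_mkcond /=.
apply: leq_sum => C _; rewrite inE; case: ifP => // /(components_is_component GV) cC.
by rewrite /good_component cC /=; case aK: (_ \in K); rewrite // KQ.
Qed.

Lemma factorial_moment_le n x lambda a b L s (K : set (R * nat)) q :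
    1 <= x -> n%:R = x ^+ 3 -> n%:R `^ (- (2 / 3)) = (x ^+ 2)^-1 ->
    0 <= p_crit n lambda <= 1 -> p_crit n lambda * x ^+ 3 <= 1 + L / x ->
    0 < a -> 0 <= b -> 0 <= L ->
    (forall z, K z -> [/\ a <= z.1, z.1 <= b & (z.2 <= s)%N]) ->
  factorial_moment n lambda K q <=
    (window_cst a b L s * expR (a ^+ 3 / 16)) ^+ q * expR (- (a ^+ 3 / 96) * q%:R ^+ 3).
Proof.
move=> x1 nx n23 p01 px a0 b0 L0 KB; have x0 : 0 < x by lra.
have x2 : 0 < x ^+ 2 by rewrite exprn_gt0.
have C0 := window_cst_gt0 b L s a0.
have -> : a ^+ 3 / 96 = a ^+ 3 / 16 / 6 by field.
apply: le_trans (prod_gaussian_le _ _ (ltW C0)); last first.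
  by rewrite divr_ge0 ?exprn_ge0 // ltW.
rewrite /factorial_moment gnp_expectE.
set Q := window (a * x ^+ 2) (b * x ^+ 2) s.
apply: (@le_trans _ _ (expect (p_crit n lambda) (vertex_pairs n)
    (fun G => ((num_good Q [set: 'I_n] G) ^_ q)%:R))).
  apply: le_expect => // G GV; rewrite ler_nat leq_ffactn // Xi_le_num_good // => C.
  move=> /set_mem /KB[/=]; rewrite n23 /surplus mulrC ler_pdivlMr // ler_pdivrMr //.
  move=> aC Cb sC; rewrite /Q /window aC Cb /=.
  by rewrite addnC -leq_subLR addnC.
apply: le_trans (mean_ffact_num_good (A := a * x ^+ 2) (N := x ^+ 3) (j := 0)
  (M := fun i => window_cst a b L s * expR (- (a ^+ 3 / 16) * i%:R ^+ 2)) q p01 _ _ _ _) _.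
- by move=> k e /and3P[].
- by move=> i; rewrite mulr_ge0 ?expR_ge0 ?ltW.
- by move=> i S Sx; exact: mean_num_good_window.
- by rewrite cardsT card_ord nx mul0r addr0.
by [].
Qed.

End CriticalWindow.

(** * Compact sets and the critical scaling *)

Section CompactSets.
Variable R : realType.
Local Open Scope classical_set_scope.

Lemma compact_exhaustion (T : ptopologicalType) (K : set T) (f : nat -> set T) :
    compact K -> (forall m, open (f m)) ->
    {homo f : m k / (m <= k)%N >-> m `<=` k} ->
    (forall z, K z -> exists m, f m z) ->
  exists m, K `<=` f m.
Proof.
rewrite compact_cover => Kc f_open f_homo Kf.
have K_cover : K `<=` classical_sets.cover classical_sets.setT f by move=> z /Kf[m fz]; exists m.
have [D _ KD] := Kc _ classical_sets.setT f (fun m _ => f_open m) K_cover.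
exists (\max_(i <- finmap.enum_fset D) i)%N => z /KD[m mD].
by apply: f_homo; apply: (leq_bigmax_seq (F := id)).
Qed.

(** The projections of K are compact; exhaust (0, oo) by the intervals
    (1 / (m + 1), m + 1) and the natural numbers by initial segments. *)
Lemma compact_in_E_bounds (K : set (R * nat)) : compact_in_E K ->
  exists a b s, [/\ 0 < a, 0 <= b &
    forall z, K z -> [/\ a <= z.1, z.1 <= b & (z.2 <= s)%N]].
Proof.
move=> [KE Kc].
have fst_compact : compact (fst @` K).
  apply: continuous_compact Kc; apply: continuous_subspaceT => z; exact: cvg_fst.
have snd_compact : compact (snd @` K).
  apply: continuous_compact Kc; apply: continuous_subspaceT => z; exact: cvg_snd.
have [M KM] : exists M : nat, fst @` K `<=` [set y | M.+1%:R^-1 < y] `&` [set y | y < M.+1%:R].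
  apply: compact_exhaustion fst_compact _ _ _.
  - by move=> m; apply: openI; [exact: open_gt | exact: open_lt].
  - move=> m k mk y [/= my ym]; split => /=.
      by apply: le_lt_trans my; rewrite lef_pV2 ?posrE ?ltr0n // ler_nat.
    by apply: lt_le_trans ym _; rewrite ler_nat.
  move=> _ [z Kz <-]; have z0 : 0 < z.1 := KE _ Kz.
  exists (maxn (Num.truncn z.1^-1) (Num.truncn z.1)); split => /=.
    rewrite invf_plt ?posrE ?ltr0n // (lt_le_trans (truncnS_gt _)) // ler_nat ltnS.
    exact: leq_maxl.
  rewrite (lt_le_trans (truncnS_gt _)) // ler_nat ltnS; exact: leq_maxr.
have [s Ks] : exists s : nat, snd @` K `<=` [set k | (k <= s)%N].
  apply: compact_exhaustion snd_compact _ _ _ => [m|m k mk j /= jm|k _].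
  - exact: discrete_open.
  - exact: leq_trans jm mk.
  by exists k => /=.
exists M.+1%:R^-1, M.+1%:R, s; split; rewrite ?invr_gt0 ?ltr0n // => z Kz.
have [/ltW ? /ltW ?] := KM z.1 (classical_sets.imageP fst Kz).
by split => //; exact: Ks (classical_sets.imageP snd Kz).
Qed.

End CompactSets.

Section CubeRoot.
Variable R : realType.
Implicit Types (n : nat) (lambda L x : R).

(** All powers of n in the statement are integral powers of x = n^(1/3), which
    makes the estimates polynomial. *)
Lemma cbrt_natr n : (0 < n)%N ->
  exists x : R, [/\ 1 <= x, n%:R = x ^+ 3, n%:R `^ (- (2 / 3)) = (x ^+ 2)^-1 &
    forall lambda, p_crit n lambda = (1 + lambda / x) / x ^+ 3].
Proof.
move=> n0; pose x := n%:R `^ (3^-1 : R).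
have x_ge0 : 0 <= x by exact: powR_ge0.
have x0 : 0 < x by rewrite powR_gt0 // ltr0n.
have xX k : n%:R `^ (k%:R / 3) = x ^+ k.
  by rewrite -powR_mulrn // -powRrM mulrC.
have nx : n%:R = x ^+ 3 by rewrite -xX divff ?powRr1 ?ler0n.
exists x; split => //.
- by rewrite -[1](powRr0 n%:R) ler_powR ?ler1n // invr_ge0.
- by rewrite powRN xX.
move=> lambda; rewrite /p_crit powRN xX nx; field; rewrite gt_eqF //.
Qed.

(** For n = 0 the conventions for inverses and powers of 0 give p_crit = 0. *)
Lemma p_crit_size_gt0 n lambda : 0 < p_crit n lambda < 1 -> (0 < n)%N.
Proof.
case: n => // /andP[]; rewrite /p_crit invr0 add0r powR0 ?mulr0 ?ltxx //.
Qed.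

Lemma p_crit_range L : 0 <= L -> exists m : nat, forall n lambda,
  (m <= n)%N -> `|lambda| <= L -> 0 < p_crit n lambda < 1.
Proof.
move=> L0; pose m := (Num.truncn (L + 2) + 1)%N.
exists (m ^ 3)%N => n lambda mn lL.
have m1 : L + 2 < m%:R by rewrite /m addn1 truncnS_gt.
have m0 : (0 < m)%N by rewrite /m addn1.
have [|x [x1 nx _ ->]] := @cbrt_natr n.
  by apply: leq_trans mn; rewrite expn_gt0 m0.
have mx : m%:R <= x.
  have : (m%:R : R) ^+ 3 <= x ^+ 3 by rewrite -nx -natrX ler_nat.
  by rewrite ler_pXn2r // ?nnegrE ?ler0n //; lra.
have x0 : 0 < x by lra.
have lx : `|lambda / x| < 1.
  by rewrite normf_div (gtr0_norm x0) ltr_pdivrMr // mul1r; lra.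
move: lx; rewrite ltr_norml => /andP[lx1 lx2].
rewrite divr_gt0 ?exprn_gt0 //=; last by lra.
rewrite ltr_pdivrMr ?exprn_gt0 // mul1r.
have : x <= x ^+ 3 by rewrite ler_eXnr.
by lra.
Qed.

End CubeRoot.

(** Both halves of the theorem follow: the constants depend on lambda only
    through a bound on its absolute value, and each n matters only through
    p_crit n lambda lying in (0, 1). *)
Lemma factorial_moment_uniform (R : realType) (L : R) (K : set (R * nat)) :
    0 <= L -> compact_in_E K ->
  exists C c : R, [/\ 0 < C, 0 < c &
    forall (q n : nat) (lambda : R), 0 < p_crit n lambda < 1 -> `|lambda| <= L ->
      factorial_moment n lambda K q <= C ^+ q * expR (- c * q%:R ^+ 3)].
Proof.
move=> L0 /compact_in_E_bounds[a [b [s [a0 b0 KB]]]].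
exists (window_cst a b L s * expR (a ^+ 3 / 16)), (a ^+ 3 / 96); split.
- by rewrite mulr_gt0 ?expR_gt0 ?window_cst_gt0.
- by rewrite divr_gt0 ?exprn_gt0.
move=> q n lambda p01 lL.
have [x [x1 nx n23 pE]] := @cbrt_natr R n (p_crit_size_gt0 p01).
have x0 : 0 < x by lra.
apply: (factorial_moment_le (x := x)) => //.
  by case/andP: p01 => /ltW-> /ltW->.
rewrite pE divfK ?gt_eqF ?exprn_gt0 // lerD2l ler_wpM2r ?invr_ge0 ?(ltW x0) //.
exact: le_trans (ler_norm _) lL.
Qed.

Theorem theorem2p1 (R : realType) :
  (forall (lambda : R) (K : set (R * nat)), compact_in_E K ->
    exists C c : R, [/\ 0 < C, 0 < c &
      forall n_lambda : nat,
        (forall n : nat, (n_lambda <= n)%N -> 0 < p_crit n lambda < 1) ->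
        forall q n : nat, (1 <= q)%N -> (n_lambda <= n)%N ->
          factorial_moment n lambda K q <= C ^+ q * expR (- c * q%:R ^+ 3)])
  /\
  (forall L : R, 0 <= L ->
    exists n_L : nat,
      (forall (n : nat) (lambda : R), (n_L <= n)%N -> `|lambda| <= L ->
        0 < p_crit n lambda < 1) /\
      forall K : set (R * nat), compact_in_E K ->
        exists C c : R, [/\ 0 < C, 0 < c &
          forall (q n : nat) (lambda : R),
            (1 <= q)%N -> (n_L <= n)%N -> `|lambda| <= L ->
            factorial_moment n lambda K q <= C ^+ q * expR (- c * q%:R ^+ 3)]).
Proof.
split=> [lambda K KE|L L0].
  have [C [c [C0 c0 bound]]] := factorial_moment_uniform (normr_ge0 lambda) KE.
  exists C, c; split=> // m mP q n _ mn; exact: bound (mP n mn) (lexx _).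
have [m mP] := p_crit_range L0; exists m; split=> [n lambda|K KE]; first exact: mP.
have [C [c [C0 c0 bound]]] := factorial_moment_uniform L0 KE.
by exists C, c; split=> // q n lambda _ mn lL; apply: bound => //; exact: mP.
Qed.
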